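(* Let $\mathbf{G}$ be a positively weighted graph, let $s,t$ be vertices, and let $F\subseteq E(T_{\mathbf{G}}(s))$ be a set of edges such that the subtrees $T_{\mathbf{G}}(s,e)$ for distinct $e\in F$ are pairwise disjoint. Let $S=\bigcup_{e\in F}V(T_{\mathbf{G}}(s,e))$. If $t\in S$, then there is an edge $\{x,y\}\in E_{\mathbf{G}}(V(\mathbf{G})\setminus S,\,S)$ with $\{x,y\}\notin F$ such that $$\pi_{\mathbf{G}\setminus F}(s,t)=\pi_{\mathbf{G}}(s,x)\circ\{x,y\}\circ\pi_{\mathbf{G}\setminus F}(y,t),$$ and moreover for such $x,y$ the path $\pi_{\mathbf{G}\setminus F}(y,t)$ contains only vertices of $S$.
   Context: For every graph $\mathbf{H}$ under consideration (including subgraphs $\mathbf{G}\setminus F$ obtained by deleting edge sets $F$) and every pair of nodes $x,y$, a canonical shortest path $\pi_{\mathbf{H}}(x,y)$ is fixed; canonical paths are closed under subpaths (if $z\in\pi_{\mathbf{H}}(x,y)$ then $\pi_{\mathbf{H}}(x,y)=\pi_{\mathbf{H}}(x,z)\circ\pi_{\mathbf{H}}(z,y)$) and consistent with edge removals (if $e\notin\pi_{\mathbf{H}}(x,y)$ then $\pi_{\mathbf{H}\setminus e}(x,y)=\pi_{\mathbf{H}}(x,y)$). $\circ$ denotes concatenation. $T_{\mathbf{G}}(s)$ is the shortest path tree of $s$ consistent with the canonical paths; for an edge $e$ of it, $T_{\mathbf{G}}(s,e)$ is the subtree of $T_{\mathbf{G}}(s)$ below $e$. $E_{\mathbf{G}}(A,B)=E(\mathbf{G})\cap(A\times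 B)$. *)

(* Defs.v *)
From HB Require Import structures.
From mathcomp Require Import all_boot all_order all_algebra.
Set Implicit Arguments. Unset Strict Implicit. Unset Printing Implicit Defensive.
Import Order.TTheory GRing.Theory Num.Theory.
Local Open Scope ring_scope.

(* Graphs: vertex set = a finType V; an (undirected) graph is given by its
   edge set H : {set {set V}} (edges are 2-element sets of vertices).
   Subgraphs G \ F are edge sets E :\: F. *)

Section Graphs.
Variables (V : finType) (R : realDomainType).

Definition path_edges (p : seq V) : seq {set V} :=
  if p is a :: q then pairmap (fun u v => [set u; v]) a q else [::].

Definition is_walk (H : {set {set V}}) (x y : V) (p : seq V) : bool :=
  if p is a :: q then [&& a == x, last a q == y & all (mem H) (path_edges p)]
  else false.

Definition path_len (w : {set V} -> R) (p : seq V) : R :=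
  \sum_(e <- path_edges p) w e.

Definition is_shortest (w : {set V} -> R) (H : {set {set V}}) (x y : V)
  (p : seq V) : Prop :=
  is_walk H x y p /\ forall p', is_walk H x y p' -> path_len w p <= path_len w p'.

(* pi H x y : the canonical shortest path in the subgraph with edge set H
   (None if y is unreachable from x in H). The axioms are required for every
   subgraph H of G (edge set E). *)
Definition canonical_paths (E : {set {set V}}) (w : {set V} -> R)
  (pi : {set {set V}} -> V -> V -> option (seq V)) : Prop :=
  forall H : {set {set V}}, H \subset E ->
  [/\ (forall x y p, pi H x y = Some p -> is_shortest w H x y p),
      (forall x y, pi H x y = None -> forall p, ~~ is_walk H x y p),
      (forall x y z p, pi H x y = Some p -> z \in p ->
         exists p1 p2, [/\ pi H x z = Some p1, pi H z y = Some p2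
                         & p = p1 ++ behead p2])
    &
      (forall x y e, e \in H ->
         (forall p, pi H x y = Some p -> e \notin path_edges p) ->
         pi (H :\ e) x y = pi H x y)].

(* e is an edge of the shortest path tree T_G(s) *)
Definition in_spt (E : {set {set V}}) (pi : {set {set V}} -> V -> V -> option (seq V))
  (s : V) (e : {set V}) : Prop :=
  exists v p, pi E s v = Some p /\ e \in path_edges p.

(* V(T_G(s,e)): vertices below the tree edge e, i.e. those whose tree path
   from s goes through e *)
Definition subtreeV (E : {set {set V}}) (pi : {set {set V}} -> V -> V -> option (seq V))
  (s : V) (e : {set V}) : {set V} :=
  [set v | if pi E s v is Some p then e \in path_edges p else false].

End Graphs.

(* Main.v *)
(* The path pi_{G\F}(s,t) starts outside S, since s lies in no subtree, and
   ends in S; let {x,y} be the edge on which it first enters S.  For a vertex v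
   outside S the tree path pi_G(s,v) uses no edge of F (otherwise v would lie
   below that edge), so deleting F does not change it: pi_{G\F}(s,v) = pi_G(s,v);
   this applies to the prefix ending at x.  Conversely, if the suffix from y
   reached a vertex z outside S, then pi_G(s,z) = pi_{G\F}(s,z) would pass
   through y, and a vertex whose tree path passes through the subtree below e
   lies itself below e, so z would be in S. *)

Require Import Defs.
From HB Require Import structures.
From mathcomp Require Import all_boot all_order all_algebra.
Set Implicit Arguments. Unset Strict Implicit. Unset Printing Implicit Defensive.
Import Order.TTheory GRing.Theory Num.Theory.
Local Open Scope ring_scope.

Section SeqSplit.
Variable T : eqType.
Implicit Types (z : T) (a b c u s : seq T).

Lemma not_uniq_cat s :
  ~~ uniq s -> exists a z b c, s = a ++ z :: b ++ z :: c.
Proof.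
elim: s => [|x s IHs] //=; rewrite negb_and negbK => /orP[/splitPr[b c] | /IHs].
  by exists [::], x, b, c.
by move=> [a [z [b [c ->]]]]; exists (x :: a), z, b, c.
Qed.

Lemma cat_cons_notin_inj (u u' c c' : seq T) z :
  z \notin u -> z \notin u' -> u ++ z :: c = u' ++ z :: c' -> u = u' /\ c = c'.
Proof.
move=> zu zu' eq_p; have size_u : size u = size u'.
  have := congr1 (index z) eq_p.
  by rewrite !index_cat (negbTE zu) (negbTE zu') /= eqxx !addn0.
by move/eqP: eq_p; rewrite eqseq_cat // => /andP[/eqP-> /eqP[->]].
Qed.

End SeqSplit.

Section Walks.
Variables (V : finType) (R : realDomainType).
Implicit Types (x y z : V) (u v p : seq V) (H : {set {set V}}).

Lemma path_edges_cat u z v :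
  path_edges (u ++ z :: v) = path_edges (rcons u z) ++ path_edges (z :: v).
Proof. by case: u => [|a u] //=; rewrite -cat_rcons pairmap_cat last_rcons. Qed.

Lemma path_len_cat (w : {set V} -> R) u z v :
  path_len w (u ++ z :: v) = path_len w (rcons u z) + path_len w (z :: v).
Proof. by rewrite /path_len path_edges_cat big_cat. Qed.

Lemma is_walk_cat H x y u z v :
  is_walk H x y (u ++ z :: v) = is_walk H x z (rcons u z) && is_walk H z y (z :: v).
Proof.
case: u => [|a u] /=; first by rewrite eqxx; case: (z == x).
rewrite -cats1 !pairmap_cat !last_cat /= eqxx !all_cat /= andbT.
by case: (a == x); case: (last z v == y);
  case: ([set last a u; z] \in H); rewrite /= ?andbF ?andbT.
Qed.

Lemma is_walk_head H x y p : is_walk H x y p -> exists v, p = x :: v.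
Proof. by case: p => //= a v /and3P[/eqP-> _ _]; exists v. Qed.

Lemma is_walk_last H x y p : is_walk H x y p -> exists u, p = rcons u y.
Proof.
case/lastP: p => [|u a] // walk_ua; exists u; congr rcons.
by case: u walk_ua => [|b u] /= /and3P[_ /eqP <- _]; rewrite ?last_rcons.
Qed.

Lemma is_walk_edges H x y p : is_walk H x y p -> all (mem H) (path_edges p).
Proof. by case: p => //= a v /and3P[]. Qed.

Lemma is_walk_subset H H' x y p : H \subset H' -> is_walk H x y p -> is_walk H' x y p.
Proof.
move=> /subsetP sHH'; case: p => //= a v /and3P[-> -> /allP Hv].
by apply/allP => e /Hv /sHH'.
Qed.

Lemma is_walk_edge H x y z v : is_walk H x y [:: x, z & v] -> [set x; z] \in H.
Proof. by case/and3P => _ _ /andP[]. Qed.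

End Walks.

Section CanonicalPaths.
Variables (V : finType) (R : realDomainType) (E : {set {set V}}) (w : {set V} -> R).
Variable pi : {set {set V}} -> V -> V -> option (seq V).
Hypotheses (w_gt0 : forall e, e \in E -> 0 < w e) (pi_canonical : canonical_paths E w pi).
Implicit Types (x y z : V) (u v p : seq V) (H F : {set {set V}}).

Lemma path_len_gt0 p : all (mem E) (path_edges p) -> path_edges p != [::] ->
  0 < path_len w p.
Proof.
rewrite /path_len; case: (path_edges p) => [//|e l /= /andP[/w_gt0 we_gt0 /allP lE] _].
by rewrite big_cons ltr_pwDl // big_seq sumr_ge0 // => f /lE /w_gt0 /ltW.
Qed.

Lemma shortest_uniq H x y p : H \subset E -> is_shortest w H x y p -> uniq p.
Proof.
(* A repeated vertex encloses a closed walk of positive weight that can be cut out. *)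
move=> sHE [walk_p min_p]; apply/negPn/negP => /not_uniq_cat[a [z [b [c def_p]]]].
move: walk_p min_p; rewrite def_p is_walk_cat (is_walk_cat _ _ _ (z :: b)).
case/and3P=> walk_az walk_zz walk_zc /(_ (a ++ z :: c)).
rewrite is_walk_cat walk_az walk_zc => /(_ isT).
rewrite path_len_cat (path_len_cat _ (z :: b)) path_len_cat addrCA gerDr.
apply/negP; rewrite -ltNge (path_len_gt0 (is_walk_edges (is_walk_subset sHE walk_zz))) //.
by rewrite -size_eq0 /= size_pairmap size_rcons.
Qed.

Lemma pi_shortest H x y p : H \subset E -> pi H x y = Some p -> is_shortest w H x y p.
Proof. by move=> /pi_canonical[shortest _ _ _]; apply: shortest. Qed.

Lemma pi_walk H x y p : H \subset E -> pi H x y = Some p -> is_walk H x y p.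
Proof. by move=> sHE /(pi_shortest sHE)[]. Qed.

Lemma pi_uniq H x y p : H \subset E -> pi H x y = Some p -> uniq p.
Proof. by move=> sHE /(pi_shortest sHE); apply: shortest_uniq. Qed.

Lemma pi_reachable H x y p :
  H \subset E -> is_walk H x y p -> exists q, pi H x y = Some q.
Proof.
move=> /pi_canonical[_ unreachable _ _] walk_p.
by case def_q: (pi H x y) => [q|]; [exists q | case/negP: (unreachable _ _ def_q p)].
Qed.

Lemma pi_refl H x p : H \subset E -> pi H x x = Some p -> p = [:: x].
Proof.
move=> sHE pi_xx; have [v def_p] := is_walk_head (pi_walk sHE pi_xx).
move: (pi_walk sHE pi_xx) (pi_uniq sHE pi_xx); rewrite def_p.
case: v {def_p} => [|a v] //= /and3P[_ /eqP last_x _] /andP[/negP x_notin _].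
by case: x_notin; rewrite -[in X in X \in _]last_x mem_last.
Qed.

Lemma pi_split H x y u z c : H \subset E -> pi H x y = Some (u ++ z :: c) ->
  pi H x z = Some (rcons u z) /\ pi H z y = Some (z :: c).
Proof.
move=> sHE pi_xy; have [_ _ subpath _] := pi_canonical sHE.
have [|p1 [p2 [pi_xz pi_zy def_p]]] := subpath _ _ z _ pi_xy.
  by rewrite mem_cat mem_head orbT.
have [u' def_p1] := is_walk_last (pi_walk sHE pi_xz).
have [c' def_p2] := is_walk_head (pi_walk sHE pi_zy).
subst p1 p2; have := pi_uniq sHE pi_xy; rewrite cat_uniq => /and3P[_ /hasPn z_notin_u _].
have := pi_uniq sHE pi_xz; rewrite rcons_uniq => /andP[z_notin_u' _].
move: def_p; rewrite cat_rcons => /cat_cons_notin_inj[||-> ->] //.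
exact: z_notin_u _ (mem_head _ _).
Qed.

Lemma pi_setD H F x y p : H \subset E -> pi H x y = Some p ->
  {in F, forall e, e \notin path_edges p} -> pi (H :\: F) x y = Some p.
Proof.
move=> sHE pi_xy p_avoids_F; rewrite -[F]set_enum.
have : {subset enum F <= F} by move=> e; rewrite mem_enum.
elim: (enum F) => [|e l IHl] sub_lF; first by rewrite set_nil setD0.
rewrite set_cons setUC -setDDl.
have IH : pi (H :\: [set:: l]) x y = Some p.
  by apply: IHl => f lf; apply/sub_lF/mem_behead.
have [eH' | eNH'] := boolP (e \in H :\: [set:: l]).
  have [_ _ _ remove_unused] := pi_canonical (subset_trans (subsetDl H [set:: l]) sHE).
  by rewrite remove_unused // IH => q [<-]; apply/p_avoids_F/sub_lF/mem_head.
by rewrite (setDidPl _) // disjoint_sym disjoints1.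
Qed.

Lemma subtreeV_source s e : s \notin subtreeV E pi s e.
Proof.
by rewrite inE; case pi_ss: (pi E s s) => [p|] //; rewrite (pi_refl (subxx E) pi_ss).
Qed.

Lemma subtreeV_desc s e u y c z : pi E s z = Some (u ++ y :: c) ->
  y \in subtreeV E pi s e -> z \in subtreeV E pi s e.
Proof.
move=> pi_sz; have [pi_sy _] := pi_split (subxx E) pi_sz.
by rewrite !inE pi_sz pi_sy path_edges_cat mem_cat => ->.
Qed.

Section Subtrees.
Variables (s : V) (F : {set {set V}}).
Local Notation S := (\bigcup_(e in F) subtreeV E pi s e).
Let sFE : E :\: F \subset E := subsetDl E F.

Lemma source_notin_subtrees : s \notin S.
Proof. by apply/bigcupP => -[e _]; apply/negP/subtreeV_source. Qed.

Lemma subtrees_desc u y c z : pi E s z = Some (u ++ y :: c) -> y \in S -> z \in S.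
Proof.
move=> pi_sz /bigcupP[e eF y_below_e]; apply/bigcupP; exists e => //.
exact: subtreeV_desc pi_sz y_below_e.
Qed.

Lemma pi_setD_subtrees z : z \notin S -> pi (E :\: F) s z = pi E s z.
Proof.
move=> zNS; case pi_sz: (pi E s z) => [p|].
  apply: (pi_setD (subxx E) pi_sz) => e eF.
  by apply: contra zNS => e_on_p; apply/bigcupP; exists e; rewrite // inE pi_sz.
case pi_F_sz: (pi (E :\: F) s z) => [q|] //.
have [p] := pi_reachable (subxx E) (is_walk_subset sFE (pi_walk sFE pi_F_sz)).
by rewrite pi_sz.
Qed.

Lemma pi_setD_enters_subtrees t p0 : t \in S -> is_walk (E :\: F) s t p0 ->
  exists x y px q,
    [/\ [set x; y] \in E, x \notin S, y \in S & [set x; y] \notin F] /\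
    [/\ pi E s x = Some px, pi (E :\: F) y t = Some q
      & pi (E :\: F) s t = Some (px ++ q)].
Proof.
move=> tS /(pi_reachable sFE)[p pi_st].
have walk_st := pi_walk sFE pi_st.
have hasS : has (mem S) p.
  have [u def_p] := is_walk_last walk_st.
  by apply/hasP; exists t; rewrite // def_p mem_rcons mem_head.
case: (split_find hasS) pi_st walk_st => y u r yS uNS.
case/lastP: u uNS => [|u x] uNS pi_st walk_st.
  have [v [y_eq_s _]] := is_walk_head walk_st.
  by move: yS; rewrite y_eq_s => sS; case/negP: source_notin_subtrees.
move: uNS; rewrite has_rcons negb_or => /andP[xNS _].
move: pi_st walk_st; rewrite cat_rcons => pi_st.
have [_ pi_yt] := pi_split sFE pi_st.
rewrite cat_rcons is_walk_cat => /andP[_ /is_walk_edge]; rewrite inE => /andP[xyNF xyE].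
have [pi_sx _] := pi_split sFE (etrans pi_st (congr1 Some (cat_rcons x u _))).
exists x, y, (rcons u x), (y :: r); split=> //; split=> //.
by rewrite -(pi_setD_subtrees xNS).
Qed.

Lemma pi_setD_suffix_in_subtrees y t px q : y \in S ->
  pi (E :\: F) y t = Some q -> pi (E :\: F) s t = Some (px ++ q) -> all (mem S) q.
Proof.
move=> yS pi_yt pi_st; have [r def_q] := is_walk_head (pi_walk sFE pi_yt).
rewrite {}def_q in pi_st *; apply/allP => z /predU1P[-> // | z_in_r].
have [// | zNS] := boolP (z \in S); case/splitPr: z_in_r pi_st => r1 r2.
rewrite -cat_cons catA => /(pi_split sFE)[pi_sz _].
rewrite (pi_setD_subtrees zNS) rcons_cat in pi_sz.
exact: subtrees_desc pi_sz yS.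
Qed.

End Subtrees.

End CanonicalPaths.

Theorem proposition6 (V : finType) (R : realDomainType)
  (E : {set {set V}}) (w : {set V} -> R)
  (pi : {set {set V}} -> V -> V -> option (seq V))
  (s t : V) (F : {set {set V}}) :
  (forall e, e \in E -> #|e| = 2%N) ->
  (forall e, e \in E -> 0 < w e) ->
  canonical_paths E w pi ->
  (forall e, e \in F -> in_spt E pi s e) ->
  (forall e1 e2, e1 \in F -> e2 \in F -> e1 != e2 ->
     [disjoint subtreeV E pi s e1 & subtreeV E pi s e2]) ->
  let S := \bigcup_(e in F) subtreeV E pi s e in
  t \in S ->
  (exists p, is_walk (E :\: F) s t p) ->
  (exists x y px q,
     [/\ [set x; y] \in E, x \notin S, y \in S & [set x; y] \notin F] /\
     [/\ pi E s x = Some px, pi (E :\: F) y t = Some q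
        & pi (E :\: F) s t = Some (px ++ q)]) /\
  (forall x y px q,
     [set x; y] \in E -> x \notin S -> y \in S -> [set x; y] \notin F ->
     pi E s x = Some px -> pi (E :\: F) y t = Some q ->
     pi (E :\: F) s t = Some (px ++ q) ->
     all (mem S) q).
Proof.
move=> _ w_gt0 pi_canon _ _ /= tS [p0 walk_p0]; split.
  exact (pi_setD_enters_subtrees w_gt0 pi_canon tS walk_p0).
move=> x y px q _ _ yS _ _ pi_yt pi_st.
exact (pi_setD_suffix_in_subtrees w_gt0 pi_canon yS pi_yt pi_st).
Qed.
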